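(* Let $E$ be a Banach lattice, let $x_1,\dots,x_n$ be a monotonic family of points in an order interval $[u,v]$ of $E$ (that is, $x_1\le\cdots\le x_n$ or $x_1\ge\cdots\ge x_n$), and let $w_1,\dots,w_n$ be real weights such that $$\sum_{k=1}^n w_k=1\quad\text{and}\quad 0\le\sum_{k=1}^m w_k\le\sum_{k=1}^n w_k\quad\text{for every } m\in\{1,\dots,n\}.$$ Then every function $f\in Cv_0([u,v],E)$ satisfies the inequality $$f\left(\sum_{k=1}^n w_kx_k\right)\le\sum_{k=1}^n w_kf(x_k)$$ in the ordering of $E$.
   Context: For elements $u\le v$ of a Banach lattice $E$, the order interval is $[u,v]=\{x\in E:u\le x\le v\}$, and the modulus of $z\in E$ is $|z|=\max\{-z,z\}$. $Cv_0([u,v],E)$ denotes the closure, in the topology of pointwise convergence (on functions $[u,v]\to E$), of the convex cone consisting of all functions $f:[u,v]\to E$ of the form $$f(x)=A(x)+\sum_{k=1}^{n}c_k|x-x_k|$$ for some affine function $A:E\to E$, some elements $x_1,\dots,x_n\in[u,v]$ and some positive coefficients $c_1,\dots,c_n$ (here $n$ and the points $x_k$ depend on $f$). *)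

(* Defs.v *)
From HB Require Import structures.
From mathcomp Require Import all_boot all_order all_algebra.
From mathcomp Require Import all_classical all_reals all_analysis.

Set Implicit Arguments.
Unset Strict Implicit.
Unset Printing Implicit Defensive.

Import Order.TTheory GRing.Theory Num.Theory.
Import numFieldNormedType.Exports.

Local Open Scope classical_set_scope.
Local Open Scope ring_scope.

(* The order is a field rather than an [Order.Lattice] parent: joining that
   structure with [CompleteNormedModule] would need intermediate structures
   below [Num.RealDomain] that the library does not provide. The instances
   that follow recover the library's order and lattice theory. *)
HB.mixin Record isBanachLattice (R : realType) E of CompleteNormedModule R E := {
  bl_le : rel E ;
  bl_join : E -> E -> E ;
  bl_meet : E -> E -> E ;
  bl_le_refl : reflexive bl_le ;
  bl_le_anti : antisymmetric bl_le ;
  bl_le_trans : transitive bl_le ;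
  bl_leUx : forall x y z, bl_le (bl_join x y) z = bl_le x z && bl_le y z ;
  bl_lexI : forall x y z, bl_le z (bl_meet x y) = bl_le z x && bl_le z y ;
  bl_leD2r : forall x y z, bl_le x y -> bl_le (x + z) (y + z) ;
  bl_le_scale : forall (a : R) x y, 0 <= a -> bl_le x y -> bl_le (a *: x) (a *: y) ;
  bl_le_norm : forall x y, bl_le (bl_join (- x) x) (bl_join (- y) y) -> `|x| <= `|y|
}.

#[short(type="banachLatticeType")]
HB.structure Definition BanachLattice (R : realType) :=
  { E of CompleteNormedModule R E & isBanachLattice R E }.

Section BanachLatticeOrder.
Context {R : realType} {E : banachLatticeType R}.

HB.instance Definition _ := Order.Le_isPOrder.Build ring_display E
  (@bl_le_refl R E) (@bl_le_anti R E) (@bl_le_trans R E).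

Let leUx (x y z : E) : (bl_join x y <= z) = (x <= z) && (y <= z).
Proof. exact: bl_leUx. Qed.

Let lexI (z x y : E) : (z <= bl_meet x y) = (z <= x) && (z <= y).
Proof. exact: bl_lexI. Qed.

HB.instance Definition _ :=
  Order.POrder_isMeetSemilattice.Build ring_display E lexI.
HB.instance Definition _ :=
  Order.POrder_isJoinSemilattice.Build ring_display E leUx.

End BanachLatticeOrder.

Section Definitions.
Context {R : realType} {E : banachLatticeType R}.

(* The lattice modulus, with values in [E]; the norm is [`|z| : R]. *)
Definition modulus (z : E) : E := Order.join (- z) z.

Definition order_interval (u v : E) : set E := [set x | u <= x <= v].

Definition affine_function (A : E -> E) : Prop :=
  forall (t : R) (x y : E),
    A ((1 - t) *: x + t *: y) = (1 - t) *: A x + t *: A y.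

Definition Cv0_cone (u v : E) : set {ptws order_interval u v -> E} :=
  [set f | exists A : E -> E, affine_function A /\
     exists (n : nat) (a : 'I_n -> order_interval u v) (c : 'I_n -> R),
       (forall k, 0 < c k) /\
       forall x : order_interval u v,
         f x = A (\val x) + \sum_(k < n) c k *: modulus (\val x - \val (a k))].

Definition Cv0 (u v : E) : set {ptws order_interval u v -> E} :=
  closure (@Cv0_cone u v).

End Definitions.

Arguments Cv0_cone {R E} u v _.
Arguments Cv0 {R E} u v _.

(* Main.v *)
(* By closedness of the positive cone, it is enough to treat the cone of
   functions, and since affine maps give equality, the single function
   [x |-> |x - a|]. Writing [y k = x k - a], the inequality
   [|\sum_k w k *: y k| <= \sum_k w k *: |y k|] says that
   [\sum_k w k *: (|y k| + y k)] and [\sum_k w k *: (|y k| - y k)] are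
   nonnegative. The families [|y k| + y k] and [|y k| - y k] are twice the
   positive and negative parts of [y k], so they are nonnegative and monotonic,
   and Abel summation concludes: the prefix sums of [w] are nonnegative
   (decreasing case), and so are the tail sums (increasing case). *)

Require Import Defs.
From mathcomp Require Import all_boot all_order all_algebra.
From mathcomp Require Import all_classical all_reals all_analysis.

Set Implicit Arguments.
Unset Strict Implicit.
Unset Printing Implicit Defensive.

Import Order.TTheory GRing.Theory Num.Theory.
Import numFieldNormedType.Exports.

Local Open Scope classical_set_scope.
Local Open Scope ring_scope.

Section BanachLatticeTheory.
Context {R : realType} {E : banachLatticeType R}.
Implicit Types (a : R) (x y z : E).

(** * Order and modulus in a Banach lattice *)

Lemma bl_leDr z x y : x <= y -> x + z <= y + z.
Proof. exact: bl_leD2r. Qed.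

Lemma bl_leD x y z t : x <= y -> z <= t -> x + z <= y + t.
Proof.
move=> xy zt; apply: (le_trans (bl_leDr z xy)).
by rewrite ![y + _]addrC; apply: bl_leDr.
Qed.

Lemma bl_subr_ge0 x y : (0 <= y - x) = (x <= y).
Proof.
apply/idP/idP => [/(bl_leDr x)|/(bl_leDr (- x))]; last by rewrite subrr.
by rewrite add0r subrK.
Qed.

Lemma bl_scale_ge0 a x : 0 <= a -> 0 <= x -> 0 <= a *: x.
Proof.
move=> a0 x0; have : (a *: 0 : E) <= a *: x by exact: bl_le_scale.
by rewrite scaler0.
Qed.

Lemma bl_addr_ge0 x y : 0 <= x -> 0 <= y -> 0 <= x + y.
Proof. by move=> x0 y0; rewrite -[0]addr0; apply: bl_leD. Qed.

Lemma bl_sum_ge0 (I : finType) (F : I -> E) :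
  (forall i, 0 <= F i) -> 0 <= \sum_i F i.
Proof. by move=> F0; elim/big_ind : _ => // x y; exact: bl_addr_ge0. Qed.

(** Translation by [z] is an order isomorphism; the less direct inequality comes from translating
    back by [- z]. *)
Lemma bl_joinD2r x y z :
  Order.join x y + z = Order.join (x + z : E) (y + z : E).
Proof.
apply: le_anti; apply/andP; split; last by rewrite leUx !bl_leDr ?leUl ?leUr.
rewrite -[leRHS](subrK z); apply: bl_leDr; rewrite leUx.
by apply/andP; split; rewrite -[leLHS](addrK z) bl_leDr ?leUl ?leUr.
Qed.

Lemma modulusN x : modulus (- x) = modulus x.
Proof. by rewrite /modulus opprK joinC. Qed.

Lemma modulus_addE x : modulus x + x = Order.join (0 : E) (x + x : E).
Proof. by rewrite /modulus bl_joinD2r addNr. Qed.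

Lemma modulus_add_ge0 x : 0 <= modulus x + x.
Proof. by rewrite modulus_addE leUl. Qed.

Lemma modulus_add_le x y : x <= y -> modulus x + x <= modulus y + y.
Proof. by move=> xy; rewrite !modulus_addE leU2// bl_leD. Qed.

Lemma modulus_le x y : (modulus x <= y) = (0 <= y + x) && (0 <= y - x).
Proof.
by rewrite /modulus leUx -[- x <= y]bl_subr_ge0 -[x <= y]bl_subr_ge0 opprK.
Qed.

(** Adding [- x <= modulus x] and [x <= modulus x] gives twice the modulus above [0]; then halve. *)
Lemma modulus_ge0 x : 0 <= modulus x.
Proof.
have : 0 <= modulus x + modulus x.
  by rewrite -(subrr x) bl_leD ?leUr ?leUl.
have h : (0 : R) <= 2^-1 by rewrite invr_ge0.
move=> /(bl_scale_ge0 h).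
rewrite -mulr2n -[modulus x *+ 2]scaler_nat scalerA.
by rewrite mulVf ?scale1r// pnatr_eq0.
Qed.

Lemma modulus_id x : 0 <= x -> modulus x = x.
Proof.
move=> x0; apply: le_anti; rewrite leUr andbT modulus_le subrr lexx andbT.
exact: bl_addr_ge0.
Qed.

Lemma modulus_norm x y : modulus x <= modulus y -> `|x| <= `|y|.
Proof. exact: bl_le_norm. Qed.

(** A point of the closure has a negative part of arbitrarily small norm, hence a zero one. *)
Lemma closed_bl_ge0 : closed [set x : E | 0 <= x].
Proof.
move=> x xcl /=; pose x' : E := Order.join (- x : E) (0 : E).
have x'0 : 0 <= x' by rewrite leUr.
suff x'E : x' = 0.
  by rewrite -[x]opprK -sub0r bl_subr_ge0 -[leRHS]x'E leUl.
apply/eqP; rewrite -normr_eq0 eq_le normr_ge0 andbT.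
apply/ler_addgt0Pl => e e0; rewrite addr0.
have [y [/= y0 xy]] := xcl _ (nbhsx_ballx x e e0).
rewrite -ball_normE /= in xy; rewrite distrC in xy.
(* [x'] is the negative part of [x]: as [0 <= y], it is at most [|y - x|]. *)
apply: le_trans (ltW xy); apply: modulus_norm; rewrite (modulus_id x'0) leUx.
rewrite modulus_ge0 andbT; apply: le_trans (_ : y - x <= _); last exact: leUr.
by rewrite -[leLHS]add0r bl_leDr.
Qed.

(** * Affine maps and continuity of weighted sums *)

Lemma affine_function_sum (A : E -> E) n (w : 'I_n -> R) (x : 'I_n -> E) :
  affine_function A -> \sum_k w k = 1 ->
  A (\sum_k w k *: x k) = \sum_k w k *: A (x k).
Proof.
move=> Aaff w1; pose B z := A z - A 0.
have AE z : A z = B z + A 0 by rewrite subrK.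
have BZ (a : R) z : B (a *: z) = a *: B z.
  rewrite /B; have := Aaff a 0 z; rewrite scaler0 add0r => ->.
  by rewrite scalerBl scale1r addrAC [A 0 - _]addrC addrK addrC scalerBr.
have BD y z : B (y + z) = B y + B z.
  have two0 : (2 : R) != 0 by rewrite pnatr_eq0.
  have halfE : 1 - 2^-1 = 2^-1 :> R by rewrite {1}(splitr 1) mul1r addrK.
  have A0E : A 0 = 2^-1 *: A 0 + 2^-1 *: A 0.
    by rewrite -scalerDl -{1}halfE subrK scale1r.
  apply: (scalerI (invr_neq0 two0)); rewrite -BZ /B scalerDr -{1}halfE Aaff.
  by rewrite halfE {1}A0E opprD addrACA -!scalerBr -scalerDr.
have B0 : B 0 = 0 by rewrite /B subrr.
rewrite AE (big_morph B BD B0) (eq_bigr (fun k => w k *: A (x k) - w k *: A 0)).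
  by rewrite sumrB -scaler_suml w1 scale1r subrK.
by move=> k _; rewrite BZ scalerBr.
Qed.

Lemma continuous_sum_scale_sub (T : topologicalType) (V : normedModType R) n
    (w : 'I_n -> R) (g : 'I_n -> T -> V) (h : T -> V) :
  (forall k, continuous (g k)) -> continuous h ->
  continuous (fun t => \sum_k w k *: g k t - h t).
Proof.
move=> gc hc t; apply: cvgB; last exact: hc.
apply: (@cvg_big _ _ _ _ _ _ _ _ _ (fun k t => w k *: g k t)) => [|k _].
  exact: add_continuous.
by apply: continuous_comp; [exact: gc|exact: scaler_continuous].
Qed.

(** * Abel summation *)

Lemma sum_le_ord_max n (w : 'I_n.+1 -> R) :
  \sum_(k < n.+1 | (k <= (ord_max : 'I_n.+1))%N) w k = \sum_k w k.
Proof. by apply: eq_bigl => k; rewrite leq_ord. Qed.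

Lemma antitone_sum_ge n (w : 'I_n.+1 -> R) (F : 'I_n.+1 -> E) :
  (forall i j : 'I_n.+1, (i <= j)%N -> F j <= F i) ->
  (forall m : 'I_n.+1, 0 <= \sum_(k < n.+1 | (k <= m)%N) w k) ->
  (\sum_k w k) *: F ord_max <= \sum_k w k *: F k.
Proof.
elim: n => [|n IHn] in w F * => Fdec w0.
  by rewrite !big_ord1 (ord1 ord_max) lexx.
rewrite big_ord_recr [leRHS]big_ord_recr /= scalerDl bl_leDr//.
pose W m : 'I_n.+2 := widen_ord (leqnSn n.+1) m.
have W0 (m : 'I_n.+1) : 0 <= \sum_(k < n.+1 | (k <= m)%N) w (W k).
  have := w0 (W m); rewrite big_mkcond big_ord_recr /= leqNgt ltn_ord addr0.
  by rewrite -big_mkcond.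
have FWdec (i j : 'I_n.+1) : (i <= j)%N -> (F \o W) j <= (F \o W) i.
  by move=> ij; apply: Fdec.
(* Induction collapses all terms but the last onto the last of their values; its coefficient is a
   prefix sum, hence nonnegative, so that value may be lowered to [F ord_max]. *)
apply: le_trans (IHn (w \o W) (F \o W) FWdec W0).
apply: bl_le_scale; last by apply: Fdec; rewrite /= leqnSn.
by have := W0 ord_max; rewrite sum_le_ord_max.
Qed.

Lemma antitone_sum_ge0 n (w : 'I_n -> R) (F : 'I_n -> E) :
  (forall i, 0 <= F i) ->
  (forall i j : 'I_n, (i <= j)%N -> F j <= F i) ->
  (forall m : 'I_n, 0 <= \sum_(k < n | (k <= m)%N) w k) ->
  0 <= \sum_k w k *: F k.
Proof.
case: n => [|n] in w F *.
  by move=> _ _ _; rewrite big_ord0 lexx.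
move=> F0 Fdec w0; apply: le_trans (antitone_sum_ge Fdec w0).
by apply: bl_scale_ge0 => //; have := w0 ord_max; rewrite sum_le_ord_max.
Qed.

(** Reversing the indices turns tail sums into prefix sums and reduces to the antitone case. *)
Lemma monotone_sum_ge0 n (w : 'I_n -> R) (F : 'I_n -> E) :
  (forall i, 0 <= F i) ->
  (forall i j : 'I_n, (i <= j)%N -> F i <= F j) ->
  (forall m : 'I_n, 0 <= \sum_(k < n | (m <= k)%N) w k) ->
  0 <= \sum_k w k *: F k.
Proof.
move=> F0 Finc w0; rewrite (reindex_inj rev_ord_inj) /=.
apply: (@antitone_sum_ge0 _ (w \o @rev_ord n) (F \o @rev_ord n)) => /= [//||m].
  by move=> i j ij; apply: Finc; rewrite /= leq_sub2l.
have := w0 (rev_ord m); rewrite (reindex_inj rev_ord_inj) /=.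
suff H (k : 'I_n) : (n - m.+1 <= n - k.+1)%N = (k <= m)%N.
  by rewrite (eq_bigl _ _ H).
by rewrite leq_sub2lE.
Qed.

(** * Steffensen weights and monotonic families *)

Definition steffensen_weights n (w : 'I_n -> R) :=
  forall m : 'I_n, 0 <= \sum_(k < n | (k <= m)%N) w k <= \sum_(k < n) w k.

Definition monotonic_family n (y : 'I_n -> E) :=
  (forall i j : 'I_n, (i <= j)%N -> y i <= y j) \/
  (forall i j : 'I_n, (i <= j)%N -> y j <= y i).

Lemma steffensen_tail_ge0 n (w : 'I_n -> R) : steffensen_weights w ->
  forall m : 'I_n, 0 <= \sum_(k < n | (m <= k)%N) w k.
Proof.
move=> hw [[|m] /= mn].
  by have /andP[] := hw (Ordinal mn); exact: le_trans.
(* The tail from [m.+1] is the total minus the prefix up to [m]. *)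
have /andP[_] := hw (Ordinal (ltnW mn)); rewrite /= -subr_ge0.
rewrite [X in X - _](bigID (fun k : 'I_n => (k <= m)%N)) /= addrAC subrr add0r.
by under eq_bigl do rewrite -ltnNge.
Qed.

Lemma steffensen_sum_ge0 n (w : 'I_n -> R) (F : 'I_n -> E) :
  steffensen_weights w -> (forall i, 0 <= F i) -> monotonic_family F ->
  0 <= \sum_k w k *: F k.
Proof.
move=> hw F0 [Finc|Fdec].
  by apply: monotone_sum_ge0 => //; exact: steffensen_tail_ge0.
by apply: antitone_sum_ge0 => // m; have /andP[] := hw m.
Qed.

Lemma monotonic_family_comp n (y : 'I_n -> E) (g : E -> E) :
  {homo g : x y / x <= y} -> monotonic_family y -> monotonic_family (g \o y).
Proof.
by move=> g_le [yinc|ydec]; [left|right] => i j ij /=; apply: g_le; auto.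
Qed.

Lemma monotonic_familyN n (y : 'I_n -> E) :
  monotonic_family y -> monotonic_family (fun k => - y k).
Proof.
have N (s t : E) : s <= t -> - t <= - s.
  by rewrite -bl_subr_ge0 -[- t <= _]bl_subr_ge0 opprK addrC.
by move=> [yinc|ydec]; [right|left] => i j ij /=; apply: N; auto.
Qed.

Lemma modulus_steffensen n (w : 'I_n -> R) (y : 'I_n -> E) :
  steffensen_weights w -> monotonic_family y ->
  modulus (\sum_k w k *: y k) <= \sum_k w k *: modulus (y k).
Proof.
move=> hw ymon; have sum_ge0 (z : 'I_n -> E) : monotonic_family z ->
    0 <= \sum_k w k *: (modulus (z k) + z k).
  move=> zmon; apply: steffensen_sum_ge0 => // [i|].
    exact: modulus_add_ge0.
  exact: (monotonic_family_comp modulus_add_le zmon).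
rewrite modulus_le -sumrN -!big_split /=; apply/andP; split.
  under eq_bigr do rewrite -scalerDr.
  exact: sum_ge0.
(* Since [modulus z - z] is [modulus (- z) + (- z)], the first half applies to the negated
   family. *)
under eq_bigr do rewrite -scalerBr -modulusN.
exact: (sum_ge0 _ (monotonic_familyN ymon)).
Qed.

End BanachLatticeTheory.

(** * The inequality on the closed cone *)

Theorem theorem7 (R : realType) (E : banachLatticeType R) (u v : E)
    (huv : u <= v)
    (n : nat) (x : 'I_n -> order_interval u v) (w : 'I_n -> R)
    (hx : (forall i j : 'I_n, (i <= j)%N -> \val (x i) <= \val (x j)) \/
          (forall i j : 'I_n, (i <= j)%N -> \val (x j) <= \val (x i)))
    (hw1 : \sum_(k < n) w k = 1)
    (hw : forall m : 'I_n,
        0 <= \sum_(k < n | (k <= m)%N) w k <= \sum_(k < n) w k)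
    (f : {ptws order_interval u v -> E}) (hf : Cv0 u v f) :
  exists xbar : order_interval u v,
    \val xbar = \sum_(k < n) w k *: \val (x k) /\
    f xbar <= \sum_(k < n) w k *: f (x k).
Proof.
pose y k := \val (x k); have ymon : monotonic_family y by [].
have xsub z : \sum_k w k *: y k - z = \sum_k w k *: (y k - z).
  under [RHS]eq_bigr do rewrite scalerBr.
  by rewrite sumrB -scaler_suml hw1 scale1r.
have shiftmon z : monotonic_family (fun k => y k - z).
  exact: (monotonic_family_comp (bl_leDr (- z)) ymon).
have yuv k : u <= y k <= v by have := valP (x k); rewrite inE.
(* Weights may be negative, so this is not plain convexity: as they sum to 1, the differences with
   [u] and [v] are weighted sums of the nonnegative monotonic families [y k - u] and [v - y k]. *)
have xbarP : \sum_k w k *: y k \in order_interval u v.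
  rewrite inE /order_interval /=; apply/andP; split; rewrite -bl_subr_ge0.
    rewrite xsub; apply: steffensen_sum_ge0 => // k.
    by rewrite bl_subr_ge0; have /andP[] := yuv k.
  rewrite -opprB xsub -sumrN; under eq_bigr do rewrite -scalerN.
  apply: steffensen_sum_ge0 => //; last exact: monotonic_familyN.
  by move=> k; rewrite opprB bl_subr_ge0; have /andP[] := yuv k.
exists (SigSub xbarP); split=> //.
set xbar := SigSub _.
rewrite -bl_subr_ge0.
(* The Jensen gap [D] uses finitely many evaluations, so it is continuous for pointwise convergence
   and its nonnegativity passes from the cone to the closure. *)
pose D (g : {ptws order_interval u v -> E}) : E :=
  \sum_k w k *: g (x k) - g xbar.
have Dcont : continuous D.
  have ev t : continuous (fun g : {ptws order_interval u v -> E} => g t : E).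
    exact: proj_continuous.
  exact: (continuous_sum_scale_sub (fun k => ev (x k)) (ev xbar)).
have Dclosed : closed (D @^-1` [set z | 0 <= z]).
  by apply: closed_comp => [g _|]; [exact: Dcont|exact: closed_bl_ge0].
apply: (Dclosed f); apply: closure_subset hf => g /=.
move=> [A [Aaff [m [a [c [c0 gE]]]]]].
rewrite /D bl_subr_ge0 gE /=.
have -> : \sum_k w k *: g (x k) = A (\sum_k w k *: y k) +
    \sum_(j < m) c j *: \sum_k w k *: modulus (y k - \val (a j)).
  rewrite affine_function_sum//.
  under [X in _ + X]eq_bigr do rewrite scaler_sumr.
  rewrite exchange_big -big_split /=; apply: eq_bigr => k _.
  rewrite gE scalerDr scaler_sumr; congr (_ + _); apply: eq_bigr => j _.
  by rewrite !scalerA mulrC.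
(* The affine parts agree; the moduli are compared separately for each centre [a j], using the
   shifted family [y k - \val (a j)]. *)
rewrite bl_leD// -bl_subr_ge0 -sumrB; apply: bl_sum_ge0 => j.
rewrite -scalerBr; apply: bl_scale_ge0; first exact: ltW.
by rewrite bl_subr_ge0 xsub modulus_steffensen.
Qed.
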